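(* Let $p\geqslant1$ and let $f_i:\mathbb{R}^D\to\mathbb{R}^D$, $f_i(x)=\alpha_i x+b_i$ with $\alpha_i\geqslant0$ and $b_i\in\mathbb{R}^D$, $i\in\{1,\ldots,p\}$. Let $j,k$ be two indices such that $\alpha_j=\max_{1\leqslant i\leqslant p}\{\alpha_i\}$ and $\alpha_k+\|b_k\|=\max_{1\leqslant i\leqslant p}\{\alpha_i+\|b_i\|\}$. Then, for all $K_0\in\mathcal{K}$, the sequence $(K_n)_n$ converges to a set $K\in\mathcal{K}$. Precisely: (i) If $b_j\neq0$, then (a) either $\alpha_j-\|b_j\|>0$, $f_i\big(-\frac{1}{\|b_j\|}b_j\big)=(\alpha_j-\|b_j\|)\big(-\frac1{\|b_j\|}b_j\big)$ for all $i\in\{1,\ldots,p\}$, and $H_\rho(K_0)=\big\{-\frac1{\|b_j\|}b_j\big\}$: in this case $K=\big\{-\frac1{\|b_j\|}b_j\big\}$; (b) or else $K$ does not depend on $K_0$: it is the attractor $L_d$ with $d=\alpha_k+\|b_k\|$, and $\frac1{\|b_k\|}b_k\in L_d$. (ii) If $b_j=0$, then (a) either $\alpha_j\geqslant\alpha_k+\|b_k\|$, and then $K=\mathrm{cl}\big(\bigcup_{n\geqslant1}K_n\big)$; (b) or else $\alpha_j<\alpha_k+\|b_k\|$, and then $K$ does not depend on $K_0$: it is the attractor $L_d$ with $d=\alpha_k+\|b_k\|$, and $\frac1{\|b_k\|}b_k\in L_d$.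
   Context: $D\geqslant1$; $\|\cdot\|$ is the Euclidean norm on $\mathbb{R}^D$. $\mathcal{K}$ is the set of non-empty compact subsets of $\mathbb{R}^D$, with the Hausdorff metric; convergence of sets is with respect to this metric. $\mathrm{cl}$ denotes closure. The radius function is $\rho(K)=\sup\{\|x\|:x\in K\}$. The Hutchinson operator is $H(K)=\bigcup_{i=1}^p f_i(K)$, and the renormalized operator is $H_\rho(K)=\frac{1}{\rho(H(K))}H(K)$. For $K_0\in\mathcal{K}$ put $K_n=H_\rho^n(K_0)$ and $d_n=\rho(H(K_n))$, so that $K_{n+1}=\frac1{d_n}H(K_n)$ for $n\geqslant0$. Standing assumption on $K_0$: $d_n>0$ for all $n\geqslant0$, so the sequences are well defined. For $d>\max_i\alpha_i$, $L_d$ denotes the unique element of $\mathcal{K}$ with $L_d=\bigcup_{i=1}^p\frac1d f_i(L_d)$ (the attractor of the contractive system $\{\frac1df_1,\ldots,\frac1df_p\}$). *)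

(* Defs.v *)
From HB Require Import structures.
From mathcomp Require Import all_boot all_order all_algebra.
From mathcomp Require Import all_classical all_reals all_analysis.

Set Implicit Arguments.
Unset Strict Implicit.
Unset Printing Implicit Defensive.

Import Order.TTheory GRing.Theory Num.Theory.
Import numFieldNormedType.Exports.

Local Open Scope classical_set_scope.
Local Open Scope ring_scope.

(* The library norm on 'rV[R]_D is the sup norm.  It induces the same topology
   as the Euclidean norm, hence the same [compact] and [closure], but metric
   quantities (radius, Hausdorff distance) must use [enorm]. *)
Definition enorm (R : realType) (D : nat) (x : 'rV[R]_D) : R :=
  Num.sqrt (\sum_(i < D) x 0 i ^+ 2).

Definition normalize (R : realType) (D : nat) (x : 'rV[R]_D) : 'rV[R]_D :=
  (enorm x)^-1 *: x.

Definition nonempty_compact (R : realType) (D : nat) : set (set 'rV[R]_D) :=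
  [set A | A !=set0 /\ compact A].

(* Real-valued [sup] and [inf] take default values on empty or unbounded sets,
   so the next four definitions are meaningful for members of
   [nonempty_compact] only. *)
Definition radius (R : realType) (D : nat) (A : set 'rV[R]_D) : R :=
  sup [set enorm x | x in A].

Definition point_dist (R : realType) (D : nat) (x : 'rV[R]_D)
    (A : set 'rV[R]_D) : R :=
  inf [set enorm (x - a) | a in A].

Definition hausdorff_dist (R : realType) (D : nat) (A B : set 'rV[R]_D) : R :=
  Num.max (sup [set point_dist x B | x in A]) (sup [set point_dist y A | y in B]).

Definition hausdorff_cvg (R : realType) (D : nat) (K : nat -> set 'rV[R]_D)
    (L : set 'rV[R]_D) : Prop :=
  hausdorff_dist (K n) L @[n --> \oo] --> (0 : R).

Definition hutchinson (R : realType) (D p : nat)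
    (f : 'I_p -> 'rV[R]_D -> 'rV[R]_D) (A : set 'rV[R]_D) : set 'rV[R]_D :=
  \bigcup_i (f i @` A).

Definition hutchinson_renorm (R : realType) (D p : nat)
    (f : 'I_p -> 'rV[R]_D -> 'rV[R]_D) (A : set 'rV[R]_D) : set 'rV[R]_D :=
  [set (radius (hutchinson f A))^-1 *: x | x in hutchinson f A].

Definition renorm_iter (R : realType) (D p : nat)
    (f : 'I_p -> 'rV[R]_D -> 'rV[R]_D) (K0 : set 'rV[R]_D) (n : nat) :
    set 'rV[R]_D :=
  iter n (hutchinson_renorm f) K0.

Definition renorm_factor (R : realType) (D p : nat)
    (f : 'I_p -> 'rV[R]_D -> 'rV[R]_D) (K0 : set 'rV[R]_D) (n : nat) : R :=
  radius (hutchinson f (renorm_iter f K0 n)).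

(* The unique element L of [nonempty_compact] fixed by the Hutchinson operator
   of the maps f_i / d.  If there is no such unique L (which does not happen
   when the f_i / d are contractions and 0 < p) the value is [set0], which is
   not a member of [nonempty_compact]. *)
Definition attractor (R : realType) (D p : nat)
    (f : 'I_p -> 'rV[R]_D -> 'rV[R]_D) (d : R) : set 'rV[R]_D :=
  xget set0 (unique (fun L : set 'rV[R]_D =>
    nonempty_compact L /\ L = hutchinson (fun i x => d^-1 *: f i x) L)).

Definition homothety (R : realType) (D p : nat)
    (alpha : 'I_p -> R) (b : 'I_p -> 'rV[R]_D) (i : 'I_p) (x : 'rV[R]_D) :
    'rV[R]_D :=
  alpha i *: x + b i.

(* Main.v *)
Require Import Defs.
From HB Require Import structures.
From mathcomp Require Import all_boot all_order all_algebra.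
From mathcomp Require Import all_classical all_reals all_analysis.
From mathcomp Require Import ring lra.

Import Order.TTheory GRing.Theory Num.Theory.
Import numFieldNormedType.Exports.

Local Open Scope classical_set_scope.
Local Open Scope ring_scope.

(** Write [f i = homothety alpha b i], [d = alpha k + enorm (b k)] and
    [e = normalize (b k)].  After one step every iterate lies in the unit ball
    and meets the unit sphere, so the scaling factors satisfy
    [alpha j - enorm (b j) <= d_n <= d] ([renorm_factor_bounds]).

    If [d <= alpha j], then [b j = 0] and all these factors equal [alpha j], so
    that the map [f j] divided by the factor is the identity: the iterates increase
    ([renorm_iter_increasing]) and converge, by compactness, to the closure of
    their union ([increasing_cvg_closure]).

    If [alpha j < d], the maps [f i / d] are contractions, and it is enough that
    [d_n] tends to [d] fast enough: the iterates then approach the invariant set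
    of the contractions ([renorm_iter_cvg_invariant]).  A point of norm close to
    1 in the direction [e] has an image of norm close to [d], so the question is
    whether [f k] drives some orbit towards [e].  Along such an orbit the
    coordinate [t] on [e] becomes [(alpha k * t + enorm (b k)) / d_n].
    - As soon as one numerator is nonnegative, [d_n <= d] makes [t] converge
      geometrically to 1 ([renorm_factor_cvg]).
    - If all numerators are negative, the inequality
      [alpha k - enorm (b k) <= alpha j - enorm (b j) <= d_n] makes [-1] a
      repelling fixed point, so every point of every iterate has [t = -1] and
      hence is [- e] ([renorm_iter_trapped]).  Then [- e] is a common
      eigenvector of the [f i], which forces [b j = b k]
      ([trapped_common_eigenvector]): this is the exceptional case, in which the
      iterates are constantly [- e].

    The attractor exists because the orbit of [e], a fixed point of [f k / d],
    increases under the Hutchinson operator; the closure of its union is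
    invariant ([invariant_set_exists]) and contains [e]. *)

(** * Euclidean geometry of row vectors *)

Definition dotp {R : realType} {D : nat} (x y : 'rV[R]_D) : R :=
  \sum_(i < D) x 0 i * y 0 i.

Lemma dotpC {R : realType} {D : nat} (x y : 'rV[R]_D) : dotp x y = dotp y x.
Proof. by apply: eq_bigr => i _; rewrite mulrC. Qed.

Lemma dotpDl {R : realType} {D : nat} (x y z : 'rV[R]_D) :
  dotp (x + y) z = dotp x z + dotp y z.
Proof. by rewrite -big_split; apply: eq_bigr => i _; rewrite mxE mulrDl. Qed.

Lemma dotpZl {R : realType} {D : nat} (a : R) (x y : 'rV[R]_D) :
  dotp (a *: x) y = a * dotp x y.
Proof. by rewrite mulr_sumr; apply: eq_bigr => i _; rewrite mxE mulrA. Qed.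

Lemma enorm_ge0 {R : realType} {D : nat} (x : 'rV[R]_D) : 0 <= enorm x.
Proof. exact: sqrtr_ge0. Qed.

Lemma enorm_sqr {R : realType} {D : nat} (x : 'rV[R]_D) :
  enorm x ^+ 2 = dotp x x.
Proof.
rewrite sqr_sqrtr; first by apply: eq_bigr => i _; rewrite expr2.
by apply: sumr_ge0 => i _; rewrite sqr_ge0.
Qed.

Lemma enorm_sqrD {R : realType} {D : nat} (x y : 'rV[R]_D) :
  enorm (x + y) ^+ 2 = enorm x ^+ 2 + 2 * dotp x y + enorm y ^+ 2.
Proof.
by rewrite !enorm_sqr dotpDl !(dotpC _ (x + y)) !dotpDl (dotpC y x); ring.
Qed.

Lemma enormZ {R : realType} {D : nat} (a : R) (x : 'rV[R]_D) :
  enorm (a *: x) = `|a| * enorm x.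
Proof.
apply/eqP; rewrite -(@eqrXn2 _ 2) ?mulr_ge0 ?enorm_ge0 //; apply/eqP.
rewrite exprMn !enorm_sqr real_normK ?num_real //.
by rewrite dotpZl dotpC dotpZl; ring.
Qed.

Lemma enormN {R : realType} {D : nat} (x : 'rV[R]_D) : enorm (- x) = enorm x.
Proof. by rewrite -scaleN1r enormZ normrN1 mul1r. Qed.

Lemma enorm0 {R : realType} {D : nat} : enorm (0 : 'rV[R]_D) = 0.
Proof. by rewrite -(scale0r 0) enormZ normr0 mul0r. Qed.

Lemma enorm_distC {R : realType} {D : nat} (x y : 'rV[R]_D) :
  enorm (x - y) = enorm (y - x).
Proof. by rewrite -enormN opprB. Qed.

Lemma norm_le_enorm {R : realType} {D : nat} (x : 'rV[R]_D) : `|x| <= enorm x.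
Proof.
rewrite [leLHS]/Num.norm /= mx_normrE bigmax_le ?enorm_ge0 // => -[i l] _ /=.
rewrite (ord1 i) -(@ler_pXn2r _ 2) ?nnegrE ?enorm_ge0 // enorm_sqr.
rewrite real_normK ?num_real // expr2 /dotp (bigD1 l) //= lerDl.
by apply: sumr_ge0 => m _; rewrite -expr2 sqr_ge0.
Qed.

Lemma enorm_eq0 {R : realType} {D : nat} (x : 'rV[R]_D) :
  enorm x <= 0 -> x = 0.
Proof.
by move=> x0; apply/eqP; rewrite -normr_le0 (le_trans (norm_le_enorm x)).
Qed.

(** Expanding the nonnegative square [enorm (enorm y *: x - enorm x *: y) ^+ 2]
    gives the inequality after division by [enorm x * enorm y]. *)
Lemma dotp_le_enorm {R : realType} {D : nat} (x y : 'rV[R]_D) :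
  dotp x y <= enorm x * enorm y.
Proof.
have [x0|xp] := leP (enorm x) 0.
  by rewrite (enorm_eq0 x x0) enorm0 mul0r -(scale0r 0) dotpZl mul0r.
have [y0|yp] := leP (enorm y) 0.
  by rewrite (enorm_eq0 y y0) enorm0 mulr0 dotpC -(scale0r 0) dotpZl mul0r.
have := sqr_ge0 (enorm (enorm y *: x + (- enorm x) *: y)).
rewrite enorm_sqrD !enormZ normrN !ger0_norm ?enorm_ge0 //.
rewrite dotpZl dotpC dotpZl (dotpC y x) => h.
rewrite -(ler_pM2l (mulr_gt0 xp yp)); nra.
Qed.

Lemma dotp_ge_enorm {R : realType} {D : nat} (x y : 'rV[R]_D) :
  - (enorm x * enorm y) <= dotp x y.
Proof.
have := dotp_le_enorm (- x) y; rewrite enormN -scaleN1r dotpZl; lra.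
Qed.

Lemma enormD {R : realType} {D : nat} (x y : 'rV[R]_D) :
  enorm (x + y) <= enorm x + enorm y.
Proof.
rewrite -(@ler_pXn2r _ 2) ?nnegrE ?addr_ge0 ?enorm_ge0 // enorm_sqrD.
by have := dotp_le_enorm x y; nra.
Qed.

Lemma enorm_triangle {R : realType} {D : nat} (y x z : 'rV[R]_D) :
  enorm (x - z) <= enorm (x - y) + enorm (y - z).
Proof. by rewrite -[x - z](subrKA y) addrC [leRHS]addrC enormD. Qed.

Lemma enorm_rdist {R : realType} {D : nat} (x y : 'rV[R]_D) :
  enorm x - enorm y <= enorm (x + y).
Proof. by have := enormD (x + y) (- y); rewrite addrK enormN; lra. Qed.

Lemma enorm_normalize {R : realType} {D : nat} (x : 'rV[R]_D) :
  0 < enorm x -> enorm (normalize x) = 1.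
Proof.
by move=> x0; rewrite enormZ ger0_norm ?invr_ge0 ?enorm_ge0 // mulVf ?gt_eqF.
Qed.

Lemma normalizeK {R : realType} {D : nat} (x : 'rV[R]_D) :
  0 < enorm x -> enorm x *: normalize x = x.
Proof. by move=> x0; rewrite scalerA mulfV ?scale1r ?gt_eqF. Qed.

(** Equality case of the Cauchy-Schwarz inequality on the unit sphere: the
    square norm of [x + e] is at most [2 + 2 * dotp x e]. *)
Lemma unit_ball_antipode {R : realType} {D : nat} (x e : 'rV[R]_D) :
  enorm x <= 1 -> enorm e = 1 -> dotp x e <= -1 -> x = - e.
Proof.
move=> x1 e1 h; apply/eqP; rewrite -addr_eq0; apply/eqP/enorm_eq0.
have := enorm_sqrD x e; rewrite e1 => h2.
by have := enorm_ge0 x; have := enorm_ge0 (x + e); nra.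
Qed.

Lemma continuous_enorm {R : realType} {D : nat} :
  continuous (@enorm R D).
Proof.
move=> x; apply: continuous_comp; last exact: sqrt_continuous.
apply: (continuous_big add_continuous) => i _ y.
apply: (@continuous_comp _ _ _ (fun z : 'rV[R]_D => z 0 i) (fun t => t ^+ 2)).
  exact: coord_continuous.
exact: exprn_continuous.
Qed.

(** * Compact sets and the Hausdorff distance *)

(** One half of the inequality [hausdorff_dist A B <= e], in a form that avoids
    suprema and infima. *)
Definition dist_le {R : realType} {D : nat} (e : R) (A B : set 'rV[R]_D) :=
  forall x, A x -> exists2 y, B y & enorm (x - y) <= e.

Lemma nbhs_enorm {R : realType} {D : nat} (x : 'rV[R]_D) (e : R) :
  0 < e -> \forall y \near x, enorm (x - y) < e.
Proof.
move=> e0; near=> y.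
have : `|enorm (x - x) - enorm (x - y)| < e.
  near: y; apply: (@cvgr_dist_lt _ _ _ _ _ (fun y => enorm (x - y))) => //.
  apply: (@continuous_comp _ _ _ (fun y : 'rV[R]_D => x - y) (@enorm R D)).
    by apply: continuousB; [exact: cst_continuous | exact: cvg_id].
  exact: continuous_enorm.
by rewrite subrr enorm0 sub0r normrN ger0_norm ?enorm_ge0.
Unshelve. all: by end_near. Qed.

Lemma closure_dist_le {R : realType} {D : nat} (A : set 'rV[R]_D) (e : R) :
  0 < e -> dist_le e (closure A) A.
Proof.
move=> e0 x /(_ _ (nbhs_enorm x e e0)) [y [Ay xy]].
by exists y => //; exact: ltW.
Qed.

Lemma dist_le_closed {R : realType} {D : nat} (A B : set 'rV[R]_D) :
  closed B -> (forall e, 0 < e -> dist_le e A B) -> A `<=` B.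
Proof.
move=> cB h x Ax; apply: cB => U /nbhs_ballP [e /= e0 eU].
have [y By xy] := h (e / 2) ltac:(by rewrite divr_gt0) x Ax.
exists y; split=> //; apply: eU; rewrite -ball_normE /=.
apply: le_lt_trans (norm_le_enorm _) _; apply: le_lt_trans xy _.
by rewrite ltr_pdivrMr // ltr_pMr // ltr1n.
Qed.

Lemma compact_unit_ball_sub {R : realType} {D : nat} (A : set 'rV[R]_D) :
  closed A -> (forall x, A x -> enorm x <= 1) -> compact A.
Proof.
move=> cA A1; apply: bounded_closed_compact => //.
exists 1; split=> [|M M1 x Ax]; first exact: num_real.
by apply: le_trans (norm_le_enorm x) _; apply: le_trans (A1 x Ax) (ltW M1).
Qed.

Lemma closure_unit_ball {R : realType} {D : nat} (A : set 'rV[R]_D) :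
  (forall x, A x -> enorm x <= 1) -> forall x, closure A x -> enorm x <= 1.
Proof.
move=> A1 x clx; apply/ler_addgt0Pr => e e0.
have [y Ay xy] := closure_dist_le A e e0 x clx.
have := enorm_rdist x (- y); rewrite enormN; have := A1 y Ay; lra.
Qed.

Lemma radius_attained {R : realType} {D : nat} (A : set 'rV[R]_D) :
  nonempty_compact A ->
  (forall x, A x -> enorm x <= Defs.radius A) /\
  exists2 x, A x & enorm x = Defs.radius A.
Proof.
move=> [A0 cA].
have [c /set_mem Ac cmax] := compact_EVT_max A0 cA
  (continuous_subspaceT (@continuous_enorm R D)).
have cub : ubound [set enorm x | x in A] (enorm c).
  by move=> _ [x Ax <-]; apply: cmax; exact/mem_set.
have cE : Defs.radius A = enorm c.
  apply/le_anti/andP; split; first by apply: ge_sup => //; exists (enorm c), c.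
  by apply: ub_le_sup; [exists (enorm c) | exists c].
by rewrite cE; split=> [x Ax|]; [apply: cub; exists x | exists c].
Qed.

Lemma hausdorff_dist_le {R : realType} {D : nat} (A B : set 'rV[R]_D) (e : R) :
  A !=set0 -> B !=set0 -> dist_le e A B -> dist_le e B A ->
  hausdorff_dist A B <= e.
Proof.
have half (X Y : set 'rV[R]_D) : X !=set0 -> dist_le e X Y ->
    sup [set point_dist x Y | x in X] <= e.
  move=> [x0 Xx0] h; apply: ge_sup; first by exists (point_dist x0 Y), x0.
  move=> _ [x Xx <-]; have [y Yy xy] := h x Xx; apply: le_trans xy.
  by apply: ge_inf; [exists 0 => _ [z _ <-]; exact: enorm_ge0 | exists y].
by move=> A0 B0 hAB hBA; rewrite /hausdorff_dist ge_max !half.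
Qed.

Lemma hausdorff_dist_ge0 {R : realType} {D : nat} (A B : set 'rV[R]_D) :
  B !=set0 -> 0 <= hausdorff_dist A B.
Proof.
move=> B0; rewrite /hausdorff_dist le_max; apply/orP; left.
have [supA|nsup] := pselect (has_sup [set point_dist x B | x in A]); last first.
  by rewrite sup_out.
have [[t [x Ax _]] _] := supA.
apply: (@le_trans _ _ (point_dist x B)); last first.
  by apply: sup_upper_bound => //; exists x.
have [y By] := B0; apply: lb_le_inf; first by exists (enorm (x - y)), y.
by move=> _ [z _ <-]; exact: enorm_ge0.
Qed.

Lemma hausdorff_cvgP {R : realType} {D : nat} (K : nat -> set 'rV[R]_D)
    (L : set 'rV[R]_D) :
  L !=set0 -> (forall n, K n !=set0) ->
  (forall e, 0 < e ->
     \forall n \near \oo, dist_le e (K n) L /\ dist_le e L (K n)) ->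
  hausdorff_cvg K L.
Proof.
move=> L0 K0 h; apply/cvgr0Pnorm_le => e e0.
near=> n; rewrite ger0_norm ?hausdorff_dist_ge0 //.
have [h1 h2] : dist_le e (K n) L /\ dist_le e L (K n) by near: n; exact: h.
exact: hausdorff_dist_le.
Unshelve. all: by end_near. Qed.

(** A point of the limit lies within [e / 2] of some [K m] with [N <= m], and
    so do its neighbours up to a further [e / 2]; compactness of the limit makes
    the choice of [m] uniform. *)
Lemma increasing_cvg_closure {R : realType} {D : nat}
    (K : nat -> set 'rV[R]_D) (N : nat) :
  (forall n, K n !=set0) ->
  (forall n, (N <= n)%N -> K n `<=` K n.+1) ->
  compact (closure (\bigcup_(n in [set n | (N <= n)%N]) K n)) ->
  hausdorff_cvg K (closure (\bigcup_(n in [set n | (N <= n)%N]) K n)).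
Proof.
set U := \bigcup_(n in _) _ => K0 Kinc cL.
have KU n : (N <= n)%N -> K n `<=` U by move=> Nn x Kx; exists n.
apply: hausdorff_cvgP => //.
  by have [x Kx] := K0 N; exists x; apply/subset_closure/(KU N (leqnn N)).
move=> e e0.
have e20 : 0 < e / 2 by rewrite divr_gt0.
have [M _ MP] : \forall n \near \oo, closure U `<=`
    [set x | exists2 y, K n y & enorm (x - y) <= e].
  apply: (compact_near_coveringP _).1 => // x clx.
  have [y [m /= Nm Kmy] xy] := closure_dist_le U _ e20 x clx.
  exists ([set x' | enorm (x - x') < e / 2], [set n | (m <= n)%N]).
    by split; [exact: nbhs_enorm | exists m].
  move=> [x' n] /= [xx' mn]; exists y.
    elim: n mn => [|n IH]; first by rewrite leqn0 => /eqP m0; rewrite -m0.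
    rewrite leq_eqVlt => /predU1P[<- //|mn]; apply: Kinc; last exact: IH.
    by apply: leq_trans Nm _.
  have := enorm_triangle x x' y; rewrite (enorm_distC x' x); lra.
exists (maxn M N) => // n /=; rewrite geq_max => /andP[Mn Nn]; split.
  move=> x Kx; exists x; first exact/subset_closure/(KU n).
  by rewrite subrr enorm0 ltW.
exact: (MP n Mn).
Qed.

(** * Hutchinson operators and their invariant sets *)

Lemma hutchinson_nonempty_compact {R : realType} {D p : nat}
    (f : 'I_p -> 'rV[R]_D -> 'rV[R]_D) (A : set 'rV[R]_D) :
  (0 < p)%N -> (forall i, continuous (f i)) -> nonempty_compact A ->
  nonempty_compact (hutchinson f A).
Proof.
move=> p0 cf [[x Ax] cA]; split.
  by exists (f (Ordinal p0) x), (Ordinal p0) => //; exists x.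
have -> : hutchinson f A = \big[setU/set0]_(i <- enum 'I_p) (f i @` A).
  rewrite -bigcup_seq; apply: eq_bigcupl; split=> i //= _.
  by rewrite mem_enum.
apply: bigsetU_compact => i _; apply: continuous_compact cA.
exact/continuous_subspaceT/cf.
Qed.

Lemma hutchinson_mono {R : realType} {D p : nat}
    (f : 'I_p -> 'rV[R]_D -> 'rV[R]_D) (A B : set 'rV[R]_D) :
  A `<=` B -> hutchinson f A `<=` hutchinson f B.
Proof.
by move=> AB _ [i _ [x Ax <-]]; exists i => //; exists x => //; exact: AB.
Qed.

Lemma expr_small {R : realType} (s M e : R) : 0 <= s -> s < 1 -> 0 < e ->
  exists N, forall n, (N <= n)%N -> M * s ^+ n <= e.
Proof.
move=> s0 s1 e0.
have : M * s ^+ n @[n --> \oo] --> M * 0.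
  by apply: cvgMr; apply: cvg_expr; rewrite ger0_norm.
rewrite mulr0 => /cvgr0Pnorm_le /(_ e e0) [N _ NP].
by exists N => n Nn; apply: le_trans (ler_norm _) (NP n Nn).
Qed.

(** Iterating the contraction turns any bound on the distance between two
    invariant sets into an arbitrarily small one. *)
Lemma invariant_set_sub {R : realType} {D p : nat} (c : R)
    (f : 'I_p -> 'rV[R]_D -> 'rV[R]_D) (A B : set 'rV[R]_D) :
  0 <= c -> c < 1 ->
  (forall i x y, enorm (f i x - f i y) <= c * enorm (x - y)) ->
  nonempty_compact A -> nonempty_compact B ->
  A = hutchinson f A -> B = hutchinson f B -> A `<=` B.
Proof.
move=> c0 c1 lip hA hB AE BE.
have [[a Aa] _] := hA; have [[b Bb] cB] := hB.
have [Abnd _] := radius_attained A hA; have [Bbnd _] := radius_attained B hB.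
have dAB n : dist_le ((Defs.radius A + Defs.radius B) * c ^+ n) A B.
  elim: n => [|n IH] x.
    move=> Ax; exists b => //; rewrite expr0 mulr1.
    by apply: le_trans (enormD _ _) _; rewrite enormN lerD ?Abnd ?Bbnd.
  rewrite {1}AE => -[i _ [x' Ax' <-]]; have [y' By' xy'] := IH x' Ax'.
  exists (f i y'); first by rewrite BE; exists i => //; exists y'.
  by apply: le_trans (lip _ _ _) _; rewrite exprS mulrCA ler_wpM2l.
apply: dist_le_closed; first exact: compact_closed (@norm_hausdorff _ _) cB.
move=> e e0 x Ax.
have [N NP] := expr_small c (Defs.radius A + Defs.radius B) e c0 c1 e0.
have [y By xy] := dAB N x Ax.
by exists y => //; apply: le_trans xy (NP N (leqnn N)).
Qed.

(** The orbit of a fixed point of one of the maps increases, so the closure of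
    its union is invariant. *)
Lemma invariant_set_exists {R : realType} {D p : nat}
    (f : 'I_p -> 'rV[R]_D -> 'rV[R]_D) (k : 'I_p) (e : 'rV[R]_D) :
  (forall i, continuous (f i)) ->
  (forall i x, enorm x <= 1 -> enorm (f i x) <= 1) ->
  enorm e <= 1 -> f k e = e ->
  exists L, [/\ nonempty_compact L, L = hutchinson f L,
    (forall x, L x -> enorm x <= 1) & L e].
Proof.
move=> cf f1 e1 fe.
pose A n := iter n (hutchinson f) [set e]; pose U := \bigcup_n A n.
have A1 n x : A n x -> enorm x <= 1.
  elim: n x => [|n IH] x /=; first by move=> ->.
  by move=> [i _ [y Ay <-]]; apply: f1; exact: IH.
have AS n : A n `<=` A n.+1.
  elim: n => [|n IH]; first by move=> _ ->; exists k => //; exists e.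
  exact: hutchinson_mono.
have U1 x : U x -> enorm x <= 1 by move=> [n _]; exact: A1.
have Ue : U e by exists 0%N.
have cU : nonempty_compact (closure U).
  split; first by exists e; exact: subset_closure.
  apply: compact_unit_ball_sub; first exact: closed_closure.
  exact: closure_unit_ball.
exists (closure U); split => //; [|exact: closure_unit_ball|exact: subset_closure].
have p0 : (0 < p)%N by apply: leq_ltn_trans (ltn_ord k).
apply/seteqP; split.
  have [_ cH] := hutchinson_nonempty_compact f (closure U) p0 cf cU.
  have cl := compact_closed (@norm_hausdorff _ _) cH.
  rewrite [X in _ `<=` X](closure_id _).1 //; apply: closureS => x [n _ Ax].
  have [i _ [y Ay <-]] := AS n x Ax.
  by exists i => //; exists y => //; apply: subset_closure; exists n.
move=> _ [i _ [x clx <-]] V Vfx.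
have [y [[n _ Ay] Vy]] := clx _ (cf i x V Vfx).
by exists (f i y); split=> //; exists n.+1 => //; exists i => //; exists y.
Qed.

Lemma attractor_unique {R : realType} {D p : nat} (c d : R)
    (f : 'I_p -> 'rV[R]_D -> 'rV[R]_D) (L : set 'rV[R]_D) :
  0 <= c -> c < 1 ->
  (forall i x y, enorm (d^-1 *: f i x - d^-1 *: f i y) <= c * enorm (x - y)) ->
  nonempty_compact L -> L = hutchinson (fun i x => d^-1 *: f i x) L ->
  attractor f d = L.
Proof.
move=> c0 c1 lip hL LE; rewrite /attractor; case: xgetP => [A _ [_ uA]|/(_ L) []].
  by apply: uA.
split=> // B [hB BE]; apply/seteqP.
by split; exact: (invariant_set_sub c _ _ _ c0 c1 lip).
Qed.

(** * Renormalized iterates *)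

Lemma renorm_iterSP {R : realType} {D p : nat}
    (f : 'I_p -> 'rV[R]_D -> 'rV[R]_D) (K0 : set 'rV[R]_D) (n : nat) x :
  renorm_iter f K0 n.+1 x <-> exists i y,
    renorm_iter f K0 n y /\ x = (renorm_factor f K0 n)^-1 *: f i y.
Proof.
split; first by move=> [_ [i _ [y Ky <-]] <-]; exists i, y.
by move=> [i [y [Ky ->]]]; exists (f i y) => //; exists i => //; exists y.
Qed.

Lemma renorm_iter_nonempty_compact {R : realType} {D p : nat}
    (f : 'I_p -> 'rV[R]_D -> 'rV[R]_D) (K0 : set 'rV[R]_D) (n : nat) :
  (0 < p)%N -> (forall i, continuous (f i)) -> nonempty_compact K0 ->
  nonempty_compact (renorm_iter f K0 n).
Proof.
move=> p0 cf h0; elim: n => [//|n IH].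
have [[x Hx] cH] := hutchinson_nonempty_compact f _ p0 cf IH.
split; first by exists ((renorm_factor f K0 n)^-1 *: x), x.
apply: continuous_compact cH; apply: continuous_subspaceT => y.
exact: scaler_continuous.
Qed.

Lemma renorm_factorP {R : realType} {D p : nat}
    (f : 'I_p -> 'rV[R]_D -> 'rV[R]_D) (K0 : set 'rV[R]_D) (n : nat) :
  (0 < p)%N -> (forall i, continuous (f i)) -> nonempty_compact K0 ->
  (forall i x, renorm_iter f K0 n x -> enorm (f i x) <= renorm_factor f K0 n) /\
  exists i x, renorm_iter f K0 n x /\ enorm (f i x) = renorm_factor f K0 n.
Proof.
move=> p0 cf h0.
have hK := renorm_iter_nonempty_compact f K0 n p0 cf h0.
have [ub [_ [i _ [x Kx <-]] xE]] :=
  radius_attained _ (hutchinson_nonempty_compact f _ p0 cf hK).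
split; last by exists i, x.
by move=> l y Ky; apply: ub; exists l => //; exists y.
Qed.

Lemma renorm_iter_unit_ball {R : realType} {D p : nat}
    (f : 'I_p -> 'rV[R]_D -> 'rV[R]_D) (K0 : set 'rV[R]_D) (n : nat) :
  (0 < p)%N -> (forall i, continuous (f i)) -> nonempty_compact K0 ->
  0 < renorm_factor f K0 n ->
  (forall x, renorm_iter f K0 n.+1 x -> enorm x <= 1) /\
  exists2 x, renorm_iter f K0 n.+1 x & enorm x = 1.
Proof.
move=> p0 cf h0 d0.
have [ub [i [x [Kx xE]]]] := renorm_factorP f K0 n p0 cf h0.
have nE y : enorm ((renorm_factor f K0 n)^-1 *: y)
    = enorm y / renorm_factor f K0 n.
  by rewrite enormZ ger0_norm ?invr_ge0 ?ltW // mulrC.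
split=> [y /renorm_iterSP [l [z [Kz ->]]]|].
  by rewrite nE ler_pdivrMr // mul1r ub.
exists ((renorm_factor f K0 n)^-1 *: f i x).
  by apply/renorm_iterSP; exists i, x.
by rewrite nE xE divff ?gt_eqF.
Qed.

(** With [r = renorm_factor f K0 n], multiplying the next iterate by [r / d]
    gives the image of the current one under the contractions
    [d^-1 *: f i]; as the next iterate lies in the unit ball, this moves its
    points by at most [`|1 - r / d|]. *)
Lemma renorm_iter_contract {R : realType} {D p : nat} (c d eta delta : R)
    (f : 'I_p -> 'rV[R]_D -> 'rV[R]_D) (K0 L : set 'rV[R]_D) (n : nat) :
  0 <= c -> 0 < d ->
  (forall i x y, enorm (d^-1 *: f i x - d^-1 *: f i y) <= c * enorm (x - y)) ->
  L = hutchinson (fun i x => d^-1 *: f i x) L ->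
  0 < renorm_factor f K0 n ->
  (forall x, renorm_iter f K0 n.+1 x -> enorm x <= 1) ->
  `|1 - renorm_factor f K0 n / d| <= eta ->
  dist_le delta (renorm_iter f K0 n) L /\
    dist_le delta L (renorm_iter f K0 n) ->
  dist_le (c * delta + eta) (renorm_iter f K0 n.+1) L /\
    dist_le (c * delta + eta) L (renorm_iter f K0 n.+1).
Proof.
move=> c0 d0 lip LE; set r := renorm_factor f K0 n => r0 K1 hr [hKL hLK].
have step i x y : renorm_iter f K0 n x -> enorm (x - y) <= delta ->
    enorm (r^-1 *: f i x - d^-1 *: f i y) <= c * delta + eta.
  move=> Kx xy; apply: le_trans (enorm_triangle (d^-1 *: f i x) _ _) _.
  rewrite addrC lerD //; first by apply: le_trans (lip _ _ _) _; rewrite ler_wpM2l.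
  have -> : d^-1 *: f i x = (r / d) *: (r^-1 *: f i x).
    by rewrite scalerA mulrAC mulfV ?gt_eqF // mul1r.
  rewrite -{1}[r^-1 *: _]scale1r -scalerBl enormZ.
  apply: le_trans hr; apply: ler_piMr => //; apply: K1.
  by apply/renorm_iterSP; exists i, x.
split=> x.
  move=> /renorm_iterSP [i [y [Ky ->]]]; have [z Lz yz] := hKL y Ky.
  exists (d^-1 *: f i z); last exact: step.
  by rewrite LE; exists i => //; exists z.
rewrite {1}LE => -[i _ [z Lz <-]]; have [y Ky zy] := hLK z Lz.
exists (r^-1 *: f i y); first by apply/renorm_iterSP; exists i, y.
by rewrite enorm_distC; apply: step => //; rewrite enorm_distC.
Qed.

(** The distances to [L] obey [delta' <= c * delta + c ^+ m].  The two rates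
    being equal, the solution decays like [m * c ^+ m]; the larger ratio
    [(1 + c) / 2] leaves room to absorb the second term. *)
Lemma renorm_iter_cvg_invariant {R : realType} {D p : nat} (c d : R)
    (f : 'I_p -> 'rV[R]_D -> 'rV[R]_D) (K0 L : set 'rV[R]_D) (N : nat) :
  0 <= c -> c < 1 -> 0 < d ->
  (forall i x y, enorm (d^-1 *: f i x - d^-1 *: f i y) <= c * enorm (x - y)) ->
  L !=set0 -> L = hutchinson (fun i x => d^-1 *: f i x) L ->
  (forall x, L x -> enorm x <= 1) ->
  (forall n, renorm_iter f K0 n !=set0) ->
  (forall n, 0 < renorm_factor f K0 n) ->
  (forall n x, renorm_iter f K0 n.+1 x -> enorm x <= 1) ->
  (forall m, `|1 - renorm_factor f K0 (N.+1 + m) / d| <= c ^+ m) ->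
  hausdorff_cvg (renorm_iter f K0) L.
Proof.
move=> c0 c1 d0 lip L0 LE L1 K0n r0 K1 hr.
(* 2 bounds the distance between points of the unit ball, and [(s - c)^-1]
   ensures [c * M + 1 <= M * s]. *)
pose s := (1 + c) / 2; pose M := 2 + (s - c)^-1.
have cs : c < s by rewrite /s; lra.
have s1 : s < 1 by rewrite /s; lra.
have s0 : 0 <= s by lra.
have Msc : 1 <= M * (s - c).
  rewrite /M mulrDl mulVf; last by rewrite gt_eqF //; lra.
  by rewrite lerDr mulr_ge0 //; lra.
have close m : dist_le (M * s ^+ m) (renorm_iter f K0 (N.+1 + m)) L /\
    dist_le (M * s ^+ m) L (renorm_iter f K0 (N.+1 + m)).
  elim: m => [|m IH].
    rewrite addn0 expr0 mulr1.
    have far x y : enorm x <= 1 -> enorm y <= 1 -> enorm (x - y) <= M.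
      move=> x1 y1; have := enormD x (- y); rewrite enormN.
      have : 0 <= (s - c)^-1 by rewrite invr_ge0; lra.
      by rewrite /M; lra.
    have [y Ly] := L0; have [x Kx] := K0n N.+1.
    split=> [z Kz|z Lz].
      by exists y => //; apply: far; [exact: K1 Kz | exact: L1].
    by exists x => //; apply: far; [exact: L1 | exact: K1 Kx].
  have weaken A B : dist_le (c * (M * s ^+ m) + c ^+ m) A B ->
      dist_le (M * s ^+ m.+1) A B.
    move=> h x Ax; have [y By xy] := h x Ax; exists y => //.
    apply: le_trans xy _; rewrite exprS.
    have csm : c ^+ m <= s ^+ m by rewrite lerXn2r ?nnegrE // ltW.
    have sm0 : 0 <= s ^+ m by rewrite exprn_ge0.
    by nra.
  rewrite addnS.
  have [h1 h2] := renorm_iter_contract c d _ _ f K0 L _ c0 d0 lip LE (r0 _)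
    (K1 _) (hr m) IH.
  by split; exact: weaken.
apply: hausdorff_cvgP => // e e0.
have [m0 hm0] := expr_small s M e s0 s1 e0.
exists (N.+1 + m0)%N => // n /= hn.
have le_n : (N.+1 <= n)%N by apply: leq_trans hn; rewrite leq_addr.
have small : M * s ^+ (n - N.+1) <= e by apply: hm0; rewrite leq_subRL.
have := close (n - N.+1)%N; rewrite subnKC // => -[h1 h2].
split=> x hx.
  by have [y hy xy] := h1 x hx; exists y => //; apply: le_trans xy small.
by have [y hy xy] := h2 x hx; exists y => //; apply: le_trans xy small.
Qed.

(** * Homotheties *)

Lemma homothety_continuous {R : realType} {D p : nat}
    (alpha : 'I_p -> R) (b : 'I_p -> 'rV[R]_D) (i : 'I_p) :
  continuous (homothety alpha b i).
Proof.
move=> x; rewrite /homothety.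
by apply: continuousD; [exact: scaler_continuous | exact: cst_continuous].
Qed.

Lemma enorm_homothety_le {R : realType} {D p : nat}
    (alpha : 'I_p -> R) (b : 'I_p -> 'rV[R]_D) (i : 'I_p) (x : 'rV[R]_D) :
  0 <= alpha i -> enorm x <= 1 ->
  enorm (homothety alpha b i x) <= alpha i + enorm (b i).
Proof.
move=> a0 x1; apply: le_trans (enormD _ _) _.
by rewrite enormZ ger0_norm // lerD2r ler_piMr.
Qed.

Lemma homothety_attractor {R : realType} {D p : nat}
    (alpha : 'I_p -> R) (b : 'I_p -> 'rV[R]_D) (j k : 'I_p) :
  (forall i, 0 <= alpha i) -> (forall i, alpha i <= alpha j) ->
  (forall i, alpha i + enorm (b i) <= alpha k + enorm (b k)) ->
  alpha j < alpha k + enorm (b k) ->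
  let d := alpha k + enorm (b k) in
  let L := attractor (homothety alpha b) d in
  [/\ nonempty_compact L,
      L = hutchinson (fun i x => d^-1 *: homothety alpha b i x) L,
      (forall x, L x -> enorm x <= 1),
      L (normalize (b k))
    & forall i x y, enorm (d^-1 *: homothety alpha b i x
        - d^-1 *: homothety alpha b i y) <= (alpha j / d) * enorm (x - y)].
Proof.
move=> a0 hj hk jd d L.
have d0 : 0 < d by apply: le_lt_trans jd; exact: a0.
have bk0 : 0 < enorm (b k) by have := hj k; lra.
have lip i x y : enorm (d^-1 *: homothety alpha b i x
    - d^-1 *: homothety alpha b i y) <= (alpha j / d) * enorm (x - y).
  rewrite -scalerBr /homothety opprD addrACA subrr addr0 -scalerBr !enormZ.
  rewrite !ger0_norm ?invr_ge0 ?(ltW d0) //.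
  by rewrite mulrA ler_wpM2r ?enorm_ge0 // mulrC ler_wpM2r // invr_ge0 ltW.
have cf i : continuous (fun x => d^-1 *: homothety alpha b i x).
  move=> x; apply: (@continuous_comp _ _ _ (homothety alpha b i)).
    exact: homothety_continuous.
  exact: scaler_continuous.
have f1 i x : enorm x <= 1 -> enorm (d^-1 *: homothety alpha b i x) <= 1.
  move=> x1; rewrite enormZ ger0_norm ?invr_ge0 ?(ltW d0) // ler_pdivrMl // mulr1.
  by apply: le_trans (hk i); exact: enorm_homothety_le.
have fe : d^-1 *: homothety alpha b k (normalize (b k)) = normalize (b k).
  rewrite /homothety -{2}(normalizeK (b k) bk0) -scalerDl scalerA mulVf ?scale1r //.
  by rewrite gt_eqF.
have e1 : enorm (normalize (b k)) <= 1 by rewrite enorm_normalize.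
have [L' [hL' L'E L'1 L'e]] := invariant_set_exists _ k _ cf f1 e1 fe.
have LE : L = L'.
  apply: (attractor_unique (alpha j / d)) => //; first by rewrite divr_ge0 // ltW.
  by rewrite ltr_pdivrMr // mul1r.
by rewrite LE.
Qed.

(** * Asymptotics of the scaling factors *)

(** Put [e = normalize (b k)] and [t n = dotp (x n) e] along the orbit
    [x n.+1 = d_n^-1 *: f_k (x n)].  As [d_n <= d], the map
    [t |-> (alpha k * t + enorm (b k)) / d], with attracting fixed point 1, is a
    lower bound for the motion of [t] as soon as the numerator is nonnegative,
    and a point of the iterate with [t] close to 1 has an image of norm close
    to [d]. *)
Lemma renorm_factor_cvg {R : realType} {D p : nat}
    (alpha : 'I_p -> R) (b : 'I_p -> 'rV[R]_D) (k : 'I_p)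
    (K0 : set 'rV[R]_D) (N : nat) (x : 'rV[R]_D) :
  let f := homothety alpha b in let d := alpha k + enorm (b k) in
  (forall i, 0 <= alpha i) -> 0 < enorm (b k) -> nonempty_compact K0 ->
  (forall n, 0 < renorm_factor f K0 n) ->
  (forall n, renorm_factor f K0 n.+1 <= d) ->
  renorm_iter f K0 N.+1 x ->
  0 <= alpha k * dotp x (normalize (b k)) + enorm (b k) ->
  forall m, d - alpha k * (alpha k / d) ^+ m <= renorm_factor f K0 (N.+2 + m).
Proof.
move=> f d a0 bk0 hK0 r0 rd Kx x0 m.
set e := normalize (b k).
have e1 : enorm e = 1 by exact: enorm_normalize.
have d0 : 0 < d by rewrite /d; have := a0 k; lra.
have p0 : (0 < p)%N by apply: leq_ltn_trans (ltn_ord k).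
have cf := homothety_continuous alpha b.
have dotf y : dotp (f k y) e = alpha k * dotp y e + enorm (b k).
  rewrite /f /homothety dotpDl dotpZl -{1}(normalizeK (b k) bk0) dotpZl.
  by rewrite -enorm_sqr e1 expr1n mulr1.
have next n y : renorm_iter f K0 n.+1 y ->
    0 <= alpha k * dotp y e + enorm (b k) ->
    exists2 z, renorm_iter f K0 n.+2 z
      & (alpha k * dotp y e + enorm (b k)) / d <= dotp z e.
  move=> Ky y0; exists ((renorm_factor f K0 n.+1)^-1 *: f k y).
    by apply/renorm_iterSP; exists k, y.
  rewrite dotpZl dotf mulrC ler_wpM2r // lef_pV2 ?posrE //.
have near1 n : exists2 z, renorm_iter f K0 (N.+2 + n) z
    & 0 <= dotp z e /\ 1 - (alpha k / d) ^+ n <= dotp z e.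
  elim: n => [|n [y Ky [y0 yn]]].
    have [z Kz hz] := next _ _ Kx x0; rewrite addn0 expr0 subrr; exists z => //.
    by split; apply: le_trans hz; rewrite divr_ge0 // ltW.
  have num0 : 0 <= alpha k * dotp y e + enorm (b k).
    by rewrite addr_ge0 ?mulr_ge0 // ltW.
  have [z Kz hz] := next _ _ Ky num0; rewrite addnS; exists z => //.
  split; apply: le_trans hz; first by rewrite divr_ge0 // ltW.
  rewrite ler_pdivlMr // exprS mulrBl mul1r mulrAC divfK ?gt_eqF //.
  by have := ler_wpM2l (a0 k) yn; rewrite /d; lra.
have [z Kz [_ hz]] := near1 m.
have [ub _] := renorm_factorP f K0 (N.+2 + m) p0 cf hK0.
apply: le_trans (ub k z Kz).
have := dotp_le_enorm (f k z) e; rewrite e1 mulr1 dotf.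
by have := ler_wpM2l (a0 k) hz; rewrite /d; lra.
Qed.

(** If all iterates stay in the half space where
    [alpha k * t + enorm (b k) < 0], then, the scaling factors being at least
    [g = alpha k - enorm (b k)], the map [t |-> (alpha k * t + enorm (b k)) / g]
    is again a lower bound for the motion of [t].  Its fixed point -1 is
    repelling, so that [t > -1] would push the orbit out of the half space.
    Hence [t = -1], which on the unit ball happens at one point only. *)
Lemma renorm_iter_trapped {R : realType} {D p : nat}
    (alpha : 'I_p -> R) (b : 'I_p -> 'rV[R]_D) (k : 'I_p)
    (K0 : set 'rV[R]_D) :
  let f := homothety alpha b in
  (forall i, 0 <= alpha i) -> 0 < enorm (b k) ->
  (forall n, 0 < renorm_factor f K0 n) ->
  (forall n x, renorm_iter f K0 n.+1 x -> enorm x <= 1) ->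
  (forall n, alpha k - enorm (b k) <= renorm_factor f K0 n.+1) ->
  (forall n x, renorm_iter f K0 n.+1 x ->
     alpha k * dotp x (normalize (b k)) + enorm (b k) < 0) ->
  forall n x, renorm_iter f K0 n.+1 x -> x = - normalize (b k).
Proof.
move=> f a0 bk0 r0 K1 rg neg n x Kx.
set e := normalize (b k) in neg *.
have e1 : enorm e = 1 by exact: enorm_normalize.
have dotf y : dotp (f k y) e = alpha k * dotp y e + enorm (b k).
  rewrite /f /homothety dotpDl dotpZl -{1}(normalizeK (b k) bk0) dotpZl.
  by rewrite -enorm_sqr e1 expr1n mulr1.
have tm1 q y : renorm_iter f K0 q.+1 y -> -1 <= dotp y e.
  move=> Ky; have := dotp_ge_enorm y e; rewrite e1 mulr1.
  by have := K1 q y Ky; lra.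
apply: unit_ball_antipode => //; first exact: K1 Kx.
set g := alpha k - enorm (b k) in rg.
have ak0 : 0 < alpha k by have := neg n x Kx; have := tm1 n x Kx; have := a0 k; nra.
have g0 : 0 < g.
  by have := neg n x Kx; have := tm1 n x Kx; rewrite /g; nra.
have s0 : 0 <= g / alpha k by rewrite divr_ge0 ?ltW.
have s1 : g / alpha k < 1 by rewrite ltr_pdivrMr // mul1r /g; lra.
have grow m : exists2 y, renorm_iter f K0 (n.+1 + m) y
    & dotp x e + 1 <= (g / alpha k) ^+ m * (dotp y e + 1).
  elim: m => [|m [y Ky hy]]; first by exists x; rewrite ?addn0 // expr0 mul1r.
  exists ((renorm_factor f K0 (n.+1 + m))^-1 *: f k y).
    by rewrite addnS; apply/renorm_iterSP; exists k, y.
  apply: le_trans hy _; rewrite exprSr -mulrA ler_wpM2l ?exprn_ge0 //.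
  have := neg _ y Ky; rewrite dotpZl dotf; have := rg (n + m)%N.
  rewrite -[(n.+1 + m)%N]/((n + m).+1); move: (r0 (n + m).+1).
  set r := renorm_factor _ _ _; set u := _ + _ => rp gr u0.
  have hu : u / g <= r^-1 * u.
    by rewrite mulrC ler_wnM2r ?(ltW u0) // lef_pV2 ?posrE.
  have -> : dotp y e + 1 = g / alpha k * (u / g + 1).
    by rewrite /u /g; field; rewrite -/g !gt_eqF.
  by rewrite ler_wpM2l // lerD2r.
have : dotp x e + 1 <= 0.
  apply/ler_addgt0Pr => eps eps0; rewrite add0r.
  have [m hm] := expr_small (g / alpha k) 1 eps s0 s1 eps0.
  have [y Ky hy] := grow m; apply: le_trans (hm m (leqnn m)).
  apply: le_trans hy _; rewrite mulrC ler_wpM2r ?exprn_ge0 //.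
  by have := neg _ y Ky; nra.
by lra.
Qed.

Lemma renorm_factor_bounds {R : realType} {D p : nat}
    (alpha : 'I_p -> R) (b : 'I_p -> 'rV[R]_D) (K0 : set 'rV[R]_D) (i k : 'I_p)
    (n : nat) :
  let f := homothety alpha b in
  (forall i, 0 <= alpha i) ->
  (forall i, alpha i + enorm (b i) <= alpha k + enorm (b k)) ->
  nonempty_compact K0 -> (forall n, 0 < renorm_factor f K0 n) ->
  alpha i - enorm (b i) <= renorm_factor f K0 n.+1 <= alpha k + enorm (b k).
Proof.
move=> f a0 hk hK0 r0; have cf := homothety_continuous alpha b.
have p0 : (0 < p)%N by apply: leq_ltn_trans (ltn_ord k).
have [K1 [x Kx x1]] := renorm_iter_unit_ball f K0 n p0 cf hK0 (r0 n).
have [ub [l [y [Ky yE]]]] := renorm_factorP f K0 n.+1 p0 cf hK0.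
apply/andP; split; last first.
  by rewrite -yE; apply: le_trans (hk l); apply: enorm_homothety_le => //; exact: K1.
have := enorm_rdist (alpha i *: x) (b i).
rewrite enormZ x1 mulr1 ger0_norm // => h; apply: le_trans h _; exact: ub.
Qed.

(** * The three regimes *)

Lemma renorm_iter_cvg_singleton {R : realType} {D p : nat} (l : R)
    (f : 'I_p -> 'rV[R]_D -> 'rV[R]_D) (K0 : set 'rV[R]_D) (u : 'rV[R]_D) :
  (0 < p)%N -> (forall i, continuous (f i)) -> nonempty_compact K0 ->
  (forall n, 0 < renorm_factor f K0 n) ->
  0 < l -> (forall i, f i u = l *: u) -> hutchinson_renorm f K0 = [set u] ->
  hausdorff_cvg (renorm_iter f K0) [set u].
Proof.
move=> p0 cf hK0 r0 l0 fu H1.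
have Ku n : renorm_iter f K0 n.+1 = [set u].
  elim: n => [//|n IH].
  have K2 x : renorm_iter f K0 n.+2 x ->
      x = ((renorm_factor f K0 n.+1)^-1 * l) *: u.
    by move=> /renorm_iterSP [i [y []]]; rewrite IH => -> ->; rewrite fu scalerA.
  have [_ [y Ky y1]] := renorm_iter_unit_ball f K0 n.+1 p0 cf hK0 (r0 _).
  have [_ [v]] := renorm_iter_unit_ball f K0 n p0 cf hK0 (r0 _).
  rewrite IH => -> u1.
  have s1 : (renorm_factor f K0 n.+1)^-1 * l = 1.
    rewrite -y1 (K2 y Ky) enormZ u1 mulr1 ger0_norm //.
    by rewrite mulr_ge0 ?invr_ge0 ?(ltW l0) ?(ltW (r0 _)).
  apply/seteqP; split=> [x /K2 ->|_ ->]; first by rewrite s1 scale1r.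
  by have := Ky; rewrite (K2 y Ky) s1 scale1r.
apply: hausdorff_cvgP; first by exists u.
  by move=> n; have [] := renorm_iter_nonempty_compact f K0 n p0 cf hK0.
move=> e e0; exists 1%N => // -[//|n] _; rewrite Ku.
by split=> _ ->; exists u => //; rewrite subrr enorm0 ltW.
Qed.

(** The images of [- normalize (b k)] under [f k] and under [f j] both have norm
    the common scaling factor; comparing them with the lower bound
    [alpha j - enorm (b j)] forces [alpha j = alpha k] and [b j = b k]. *)
Lemma trapped_common_eigenvector {R : realType} {D p : nat}
    (alpha : 'I_p -> R) (b : 'I_p -> 'rV[R]_D) (K0 : set 'rV[R]_D)
    (j k : 'I_p) :
  let f := homothety alpha b in let u := - normalize (b j) in
  (forall i, 0 <= alpha i) -> (forall i, alpha i <= alpha j) ->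
  (forall i, alpha i + enorm (b i) <= alpha k + enorm (b k)) ->
  nonempty_compact K0 -> (forall n, 0 < renorm_factor f K0 n) ->
  0 < enorm (b k) ->
  (forall n x, renorm_iter f K0 n.+1 x -> x = - normalize (b k)) ->
  b j != 0 /\ [/\ 0 < alpha j - enorm (b j),
    forall i, f i u = (alpha j - enorm (b j)) *: u
    & hutchinson_renorm f K0 = [set u]].
Proof.
move=> f u a0 hj hk hK0 r0 bk0 trap; have cf := homothety_continuous alpha b.
have p0 : (0 < p)%N by apply: leq_ltn_trans (ltn_ord k).
set e := normalize (b k) in trap.
have e1 : enorm e = 1 by exact: enorm_normalize.
have Ke n : renorm_iter f K0 n.+1 (- e).
  have [[x Kx] _] := renorm_iter_nonempty_compact f K0 n.+1 p0 cf hK0.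
  by rewrite -(trap n x Kx).
set r := renorm_factor f K0 1.
have rp : 0 < r by exact: r0.
have fe i : f i (- e) = r *: - e.
  have h : r^-1 *: f i (- e) = - e.
    by apply: (trap 1%N); apply/renorm_iterSP; exists i, (- e).
  by rewrite -[in RHS]h scalerA mulfV ?scale1r ?gt_eqF.
have bE i : b i = (alpha i - r) *: e.
  have := fe i; rewrite /f /homothety !scalerN => h.
  by rewrite scalerBl -h addrA subrr add0r.
have rE : r = alpha k - enorm (b k).
  suff : enorm (b k) = alpha k - r by lra.
  have := bE k; rewrite -{1}(normalizeK (b k) bk0) => /eqP.
  rewrite -subr_eq0 -scalerBl scaler_eq0 => /orP[|/eqP eq0]; first by move/eqP; lra.
  by have := e1; rewrite /e eq0 enorm0 => /esym/eqP; rewrite oner_eq0.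
have /andP[rj _] := renorm_factor_bounds alpha b K0 j k 0 a0 hk hK0 r0.
rewrite -/f -/r in rj.
have hkj := hk j; have hjk := hj k.
have aE : alpha j = alpha k by lra.
have bjk : b j = b k by rewrite !bE aE.
rewrite /u bjk -/e aE -rE; split.
  by apply: contraTneq bk0 => ->; rewrite enorm0 ltxx.
split=> //; apply/seteqP; split=> [x /(trap 0%N) //|_ ->]; exact: (Ke 0%N).
Qed.

Lemma renorm_iter_cvg_attractor {R : realType} {D p : nat}
    (alpha : 'I_p -> R) (b : 'I_p -> 'rV[R]_D) (K0 : set 'rV[R]_D)
    (j k : 'I_p) (N : nat) (x : 'rV[R]_D) :
  let f := homothety alpha b in let d := alpha k + enorm (b k) in
  (forall i, 0 <= alpha i) -> (forall i, alpha i <= alpha j) ->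
  (forall i, alpha i + enorm (b i) <= d) -> alpha j < d ->
  nonempty_compact K0 -> (forall n, 0 < renorm_factor f K0 n) ->
  renorm_iter f K0 N.+1 x ->
  0 <= alpha k * dotp x (normalize (b k)) + enorm (b k) ->
  hausdorff_cvg (renorm_iter f K0) (attractor f d).
Proof.
move=> f d a0 hj hk jd hK0 r0 Kx x0; have cf := homothety_continuous alpha b.
have p0 : (0 < p)%N by apply: leq_ltn_trans (ltn_ord k).
have d0 : 0 < d by apply: le_lt_trans jd; exact: a0.
have bk0 : 0 < enorm (b k) by have := hj k; rewrite /d in jd; lra.
have [[L0 _] LE L1 _ lip] := homothety_attractor alpha b j k a0 hj hk jd.
have rd n : renorm_factor f K0 n.+1 <= d.
  by have /andP[] := renorm_factor_bounds alpha b K0 k k n a0 hk hK0 r0.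
have c0 : 0 <= alpha j / d by rewrite divr_ge0 // ltW.
have c1 : alpha j / d < 1 by rewrite ltr_pdivrMr // mul1r.
apply: (renorm_iter_cvg_invariant _ _ _ _ _ N.+1 c0 c1 d0 lip) => //.
- by move=> n; have [] := renorm_iter_nonempty_compact f K0 n p0 cf hK0.
- by move=> n; have [] := renorm_iter_unit_ball f K0 n p0 cf hK0 (r0 n).
move=> m.
have rm := renorm_factor_cvg alpha b k K0 N x a0 bk0 hK0 r0 rd Kx x0 m.
rewrite -/f -/d in rm; rewrite ger0_norm; last first.
  by rewrite subr_ge0 ler_pdivrMr // mul1r; exact: rd.
have ck0 : 0 <= alpha k / d by rewrite divr_ge0 // ltW.
have ckj : alpha k / d <= alpha j / d by rewrite ler_wpM2r ?invr_ge0 ?(ltW d0).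
have ckm : (alpha k / d) ^+ m <= (alpha j / d) ^+ m by rewrite lerXn2r ?nnegrE.
apply: le_trans ckm; rewrite lerBlDr -lerBlDl ler_pdivlMr //.
apply: le_trans rm; rewrite mulrBl mul1r lerD2l lerN2 mulrC.
rewrite ler_wpM2l ?exprn_ge0 //; rewrite /d; have := enorm_ge0 (b k); lra.
Qed.

(** Here [f j] is the linear homothety of ratio [alpha j] and every scaling
    factor after the first one equals [alpha j], so that each point of an
    iterate is fixed and stays in the next iterate. *)
Lemma renorm_iter_increasing {R : realType} {D p : nat}
    (alpha : 'I_p -> R) (b : 'I_p -> 'rV[R]_D) (K0 : set 'rV[R]_D)
    (j k : 'I_p) (n : nat) :
  let f := homothety alpha b in
  (forall i, 0 <= alpha i) ->
  (forall i, alpha i + enorm (b i) <= alpha k + enorm (b k)) ->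
  alpha k + enorm (b k) <= alpha j ->
  nonempty_compact K0 -> (forall n, 0 < renorm_factor f K0 n) ->
  renorm_iter f K0 n.+1 `<=` renorm_iter f K0 n.+2.
Proof.
move=> f a0 hk dj hK0 r0 x Kx.
have bj0 : b j = 0 by apply: enorm_eq0; have := hk j; lra.
have := renorm_factor_bounds alpha b K0 j k n a0 hk hK0 r0.
rewrite -/f bj0 enorm0 subr0 => /andP[ja jd].
have rE : renorm_factor f K0 n.+1 = alpha j by lra.
apply/renorm_iterSP; exists j, x; split=> //.
rewrite /f /homothety bj0 addr0 scalerA -/f rE mulVf ?scale1r //.
by rewrite -rE gt_eqF.
Qed.

Theorem theorem2p8 (R : realType) (D p : nat) (hD : (1 <= D)%N) (hp : (1 <= p)%N)
    (alpha : 'I_p -> R) (b : 'I_p -> 'rV[R]_D)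
    (halpha : forall i, 0 <= alpha i)
    (j k : 'I_p)
    (hj : forall i, alpha i <= alpha j)
    (hk : forall i, alpha i + enorm (b i) <= alpha k + enorm (b k))
    (K0 : set 'rV[R]_D) (hK0 : nonempty_compact K0)
    (hd : forall n : nat, 0 < renorm_factor (homothety alpha b) K0 n) :
  exists K : set 'rV[R]_D,
    [/\ nonempty_compact K,
        hausdorff_cvg (renorm_iter (homothety alpha b) K0) K,
        b j != 0 ->
          let u := - normalize (b j) in
          let case_a :=
            [/\ 0 < alpha j - enorm (b j),
                forall i, homothety alpha b i u = (alpha j - enorm (b j)) *: u
              & hutchinson_renorm (homothety alpha b) K0 = [set u]] in
          (case_a -> K = [set u]) /\
          (~ case_a ->
             K = attractor (homothety alpha b) (alpha k + enorm (b k)) /\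
             attractor (homothety alpha b) (alpha k + enorm (b k))
               (normalize (b k)))
      & b j = 0 ->
          (alpha k + enorm (b k) <= alpha j ->
             K = closure (\bigcup_(n in [set n : nat | (1 <= n)%N])
                            renorm_iter (homothety alpha b) K0 n)) /\
          (alpha j < alpha k + enorm (b k) ->
             K = attractor (homothety alpha b) (alpha k + enorm (b k)) /\
             attractor (homothety alpha b) (alpha k + enorm (b k))
               (normalize (b k)))].
Proof.
have cf := homothety_continuous alpha b.
have K0n n := renorm_iter_nonempty_compact (homothety alpha b) K0 n hp cf hK0.
have K1 n := renorm_iter_unit_ball (homothety alpha b) K0 n hp cf hK0 (hd n).
set u := - normalize (b j).
set case_a := [/\ 0 < alpha j - enorm (b j),
  forall i, homothety alpha b i u = (alpha j - enorm (b j)) *: u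
  & hutchinson_renorm (homothety alpha b) K0 = [set u]].
have [[bj0 ca]|nca] := pselect (b j != 0 /\ case_a).
  have [l0 fu H1] := ca; exists [set u]; split => //.
  - by split; [exists u | exact: compact_set1].
  - exact: (renorm_iter_cvg_singleton _ _ _ _ hp cf hK0 hd l0 fu H1).
  - by move/eqP: bj0.
have [jd|dj] := ltP (alpha j) (alpha k + enorm (b k)).
  have [hL _ _ Le _] := homothety_attractor alpha b j k halpha hj hk jd.
  exists (attractor (homothety alpha b) (alpha k + enorm (b k))); split => //.
  - have bk0 : 0 < enorm (b k) by have := hj k; lra.
    have [[N [x [Kx x0]]]|neg] := pselect (exists N x,
        renorm_iter (homothety alpha b) K0 N.+1 x /\
        0 <= alpha k * dotp x (normalize (b k)) + enorm (b k)).
      exact: (renorm_iter_cvg_attractor alpha b K0 j k N x).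
    (* No iterate ever reaches the half space of nonnegative numerators, so the
       orbit is trapped at the antipode of [normalize (b k)]. *)
    exfalso; apply: nca.
    apply: (trapped_common_eigenvector alpha b K0 j k) => //.
    apply: renorm_iter_trapped => //.
    + by move=> n; have [] := K1 n.
    + move=> n.
      have /andP[rj _] := renorm_factor_bounds alpha b K0 j k n halpha hk hK0 hd.
      by apply: le_trans rj; have := hk j; have := hj k; lra.
    + move=> n x Kx; rewrite ltNge; apply/negP => x0.
      by apply: neg; exists n, x.
  - by move=> bj0 u' ca'; split=> // ca; case: nca.
have bj0 : b j = 0 by apply: enorm_eq0; have := hk j; lra.
set U := closure _.
have cU : compact U.
  apply: compact_unit_ball_sub; first exact: closed_closure.
  by apply: closure_unit_ball => x [[//|n] _ Kx]; have [h _] := K1 n; exact: h.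
exists U; split => //.
- split=> //; have [[x Kx] _] := K0n 1%N.
  by exists x; apply: subset_closure; exists 1%N.
- apply: increasing_cvg_closure => // [n|[//|n] _]; first by have [] := K0n n.
  exact: (renorm_iter_increasing alpha b K0 j k n).
- by rewrite bj0 eqxx.
Qed.
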